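(* Let $p>2$. There are constants $c,C>0$ depending only on $p$ such that for every sufficiently small $\varepsilon>0$ and every $n\ge C d/\varepsilon^p$ the following holds. Any randomized algorithm that, given $A\in\mathbb{R}^{n\times d}$, query access to the entries of an unknown $b\in\mathbb{R}^n$, and $f\in\mathsf{Lip}_1$, outputs $\hat x\in\mathbb{R}^d$ such that, for every such input, with probability at least $4/5$, $$\|f(A\hat x)-b\|_p^p\le \mathsf{OPT}+\varepsilon\big(\mathsf{OPT}+\|Ax^*\|_p^p\big),$$ must, on some input, make at least $c\,d/\varepsilon^p$ queries to the entries of $b$.
   Context: $\mathsf{Lip}_1$ is the set of $f:\mathbb{R}\to\mathbb{R}$ with $f(0)=0$ and $|f(x)-f(y)|\le|x-y|$; $f$ is applied entrywise to vectors. $\mathsf{OPT}:=\min_{x\in\mathbb{R}^d}\|f(Ax)-b\|_p^p$ and $x^*$ is a minimizer of $\|Ax\|_p^p$ among all $x$ attaining $\mathsf{OPT}$. *)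

(* Defs.v *)
From HB Require Import structures.
From mathcomp Require Import all_boot all_order all_algebra.
From mathcomp Require Import all_classical all_reals all_analysis.
Set Implicit Arguments. Unset Strict Implicit. Unset Printing Implicit Defensive.
Import Order.TTheory GRing.Theory Num.Theory.
Local Open Scope ring_scope.

Definition Lip1 (R : realType) (f : R -> R) : Prop :=
  f 0 = 0 /\ forall x y : R, `|f x - f y| <= `|x - y|.

Definition lpp (R : realType) (n : nat) (p : R) (v : 'cV[R]_n) : R :=
  \sum_(i < n) (`|v i 0|) `^ p.

Definition cost (R : realType) (n d : nat) (p : R) (A : 'M[R]_(n, d))
  (f : R -> R) (b : 'cV[R]_n) (x : 'cV[R]_d) : R :=
  lpp p (map_mx f (A *m x) - b).

Definition is_opt (R : realType) (n d : nat) (p : R) A f b (x : 'cV[R]_d) : Prop :=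
  forall y : 'cV[R]_d, @cost R n d p A f b x <= cost p A f b y.

Definition is_xstar (R : realType) (n d : nat) (p : R) A f b (x : 'cV[R]_d) : Prop :=
  @is_opt R n d p A f b x /\
  forall y, is_opt p A f b y -> lpp p (A *m x) <= lpp p (A *m y).

(* The required accuracy guarantee for the output xh.  Stated for every x*
   (all such xs have the same ||A xs||_p^p, and OPT = cost xs). *)
Definition good_output (R : realType) (n d : nat) (p eps : R) A f b
  (xh : 'cV[R]_d) : Prop :=
  forall xs, @is_xstar R n d p A f b xs ->
    cost p A f b xh <= cost p A f b xs + eps * (cost p A f b xs + lpp p (A *m xs)).

(* A deterministic adaptive query strategy for the entries of b in R^n:
   from the answers received so far it either queries a new index
   (Some i) or stops (None); upon stopping it outputs [q_out answers]. *)
Record query_alg (R : Type) (n d : nat) := QueryAlg {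
  q_next : seq R -> option 'I_n ;
  q_out : seq R -> 'cV[R]_d }.

Fixpoint history (R : Type) (n d : nat) (D : query_alg R n d) (b : 'cV[R]_n)
  (k : nat) : seq R :=
  match k with
  | 0 => [::]
  | k.+1 => let h := history D b k in
            match q_next D h with
            | Some i => rcons h (b i 0)
            | None => h
            end
  end.

Definition halts_with (R : Type) (n d : nat) (D : query_alg R n d) b xh : Prop :=
  exists k, q_next D (history D b k) = None /\ q_out D (history D b k) = xh.

Definition makes_at_least (R : realType) (n d : nat) (D : query_alg R n d) b
  (t : R) : Prop :=
  forall j : nat, j%:R < t -> q_next D (history D b j) <> None.

(* A randomized algorithm: given A and f (known), with random seed w drawn from
   a probability space, runs a deterministic adaptive query strategy on b. *)
Definition rand_alg (R : realType) (n d : nat) (T : Type) :=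
  'M[R]_(n, d) -> (R -> R) -> T -> query_alg R n d.

(* "for every input, with probability at least 4/5, the output is good";
   probability is read as inner probability (no measurability assumption). *)
Definition succeeds (R : realType) (n d : nat) (p eps : R)
  (dsp : measure_display) (Om : measurableType dsp) (P : probability Om R)
  (alg : rand_alg R n d Om) : Prop :=
  forall (A : 'M[R]_(n, d)) (b : 'cV[R]_n) (f : R -> R), Lip1 f ->
    exists S : set Om, measurable S /\ ((4 / 5)%:E <= P S)%E /\
      forall w, S w -> exists xh, halts_with (alg A f w) b xh /\
                                  good_output p eps A f b xh.

(* Main.v *)
Require Import Defs.
From HB Require Import structures.
From mathcomp Require Import all_boot all_order all_algebra.
From mathcomp Require Import all_classical all_reals all_analysis.
From mathcomp Require Import measurable_realfun zify ring lra.
Import Order.TTheory GRing.Theory Num.Theory.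
Local Open Scope ring_scope.

(** Put [delta = 40 eps], let [f] clamp to [[0, delta]], and let [A] be block
diagonal with one column per block, each block consisting of [h ~ 1 / delta^p]
rows [1] and [h] rows [-1]; the remaining rows vanish.  In each block all
entries of [b] are [delta], except for one hidden "needle" equal to [1].
On the block only one of [f x], [f (- x)] is nonzero, so the bulk of the
entries cannot tell [x = delta] from [x = - delta]; but reaching the needle
gains [1 - delta^p - (1 - delta)^p >= delta], so the sign of [x] has to match
the row of the needle.  The allowed error is at most [4 eps = delta / 10] per
block, hence an accurate output has the wrong sign in at most a tenth of the
blocks.  Averaging over the position of the needles, an algorithm making at
most [h d / 64] queries misses the needle in at least 3/4 of the blocks, and
flipping the sign of a missed needle does not change the output; so the
expected fraction of wrong blocks is at least 3/8, while success with
probability 4/5 allows at most 4/5 * 1/10 + 1/5. *)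

(** * Query traces *)

Section Trace.
Context {R : realType} {n d : nat} (D : query_alg R n d).
Implicit Types b : 'cV[R]_n.

(** [history] keeps only the answers; the queried indices are needed to say that two inputs agree on
    everything seen. *)
Fixpoint trace b (k : nat) : seq 'I_n :=
  if k is k'.+1 then
    if q_next D (history D b k') is Some i then rcons (trace b k') i
    else trace b k'
  else [::].

Lemma history_trace b k : history D b k = [seq b i 0 | i <- trace b k].
Proof.
elim: k => //= k ->; case: (q_next D _) => // i.
by rewrite map_rcons.
Qed.

Lemma prefix_trace b k l : (k <= l)%N -> prefix (trace b k) (trace b l).
Proof.
elim: l => [|l IH]; first by rewrite leqn0 => /eqP->.
rewrite leq_eqVlt => /orP[/eqP->|]; first exact: prefix_refl.
rewrite ltnS => /IH /= h; case: (q_next D _) => // i.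
exact: prefix_trans h (prefix_rcons _ _).
Qed.

Lemma size_trace b k : (size (trace b k) <= k)%N.
Proof.
elim: k => //= k IH; case: (q_next D _) => [i|]; last exact: leqW.
by rewrite size_rcons.
Qed.

(** Each query is a function of the earlier answers, so by induction the two runs never part. *)
Lemma trace_agree b b' k :
  {in trace b k, forall i, b i 0 = b' i 0} -> trace b' k = trace b k.
Proof.
elim: k => //= k IH h.
have e : trace b' k = trace b k.
  apply: IH => i ik; apply: h; case: (q_next D _) => // j.
  by rewrite mem_rcons inE ik orbT.
suff -> : history D b' k = history D b k by rewrite e.
rewrite !history_trace e; apply/eq_in_map => i ik; rewrite h //.
by case: (q_next D _) => // j; rewrite mem_rcons inE ik orbT.
Qed.

Lemma history_agree b b' k :
  {in trace b k, forall i, b i 0 = b' i 0} -> history D b' k = history D b k.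
Proof.
move=> h; rewrite !history_trace (trace_agree _ _ _ h).
by apply/eq_in_map => i ik; rewrite h.
Qed.

Lemma history_halted b k l : (k <= l)%N ->
  q_next D (history D b k) = None -> history D b l = history D b k.
Proof.
move=> kl h; elim: l kl => [|l IH]; first by rewrite leqn0 => /eqP->.
rewrite leq_eqVlt => /orP[/eqP->//|]; rewrite ltnS => /IH /= ->.
by rewrite h.
Qed.

Lemma halts_with_history b k xh : q_next D (history D b k) = None ->
  halts_with D b xh -> xh = q_out D (history D b k).
Proof.
move=> hk [l [hl <-]]; have [kl|/ltnW lk] := leqP k l.
  by rewrite (history_halted _ _ _ kl).
by rewrite (history_halted _ _ _ lk).
Qed.

End Trace.

(** * Averaging over hidden needles *)

Section Average.
Context {R : realType} {dsp : measure_display} {Om : measurableType dsp}.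

Lemma probability_inhabited (P : probability Om R) : exists w : Om, True.
Proof.
suff [w _] : ([set: Om] !=set0)%classic by exists w.
apply/set0P/eqP => e; have := probability_setT P.
by rewrite e measure0 => /eqP; rewrite eq_sym onee_eq0.
Qed.

(** Easy half of Yao's principle: the expected number of [i] with [w] in [S i] is at least
    [a * #|I|], so some fixed seed does as well as the average. *)
Lemma exists_popular (P : probability Om R) (I : finType) (S : I -> set Om)
    (a : R) :
  (forall i, measurable (S i)) -> (forall i, (a%:E <= P (S i))%E) ->
  exists w, a * #|I|%:R <= #|[set i | w \in S i]|%:R :> R.
Proof.
move=> mS PS; apply: contrapT => /forallNP H.
pose c w := #|[set i | w \in S i]|.
have cE w : \sum_(i : I) (\1_(S i) w)%:E = (c w)%:R%:E :> \bar R.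
  rewrite sumEFin; congr EFin.
  rewrite /c -sum1_card natr_sum [RHS]big_mkcond /=; apply: eq_bigr => i _.
  by rewrite inE indicE; case: (w \in S i).
have [w0 _] := probability_inhabited P.
(* The count takes finitely many values; bounding the integral by its maximum, attained at [w1],
   keeps the inequality strict. *)
have [w1 w1P] : exists w1, forall w, (c w <= c w1)%N.
  have exP : exists m, `[< exists w, c w = m >].
    by exists (c w0); apply/asboolP; exists w0.
  have ub m : `[< exists w, c w = m >] -> (m <= #|I|)%N.
    by move=> /asboolP[w <-]; exact: max_card.
  case: (ex_maxnP exP ub) => m /asboolP[w1 e] mP; exists w1 => w.
  by rewrite e; apply: mP; apply/asboolP; exists w.
have /negP := H w1; rewrite -ltNge => lt1.
have : (\sum_(i : I) P (S i) <= (c w1)%:R%:E)%E.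
  have -> : (\sum_(i : I) P (S i) = \int[P]_w (c w)%:R%:E)%E.
    under eq_integral do rewrite -cE.
    rewrite ge0_integral_sum //=.
    - by apply: eq_bigr => i _; rewrite integral_indic // setIT.
    - by move=> i; apply/measurable_EFinP; exact: measurable_indic.
  have -> : (c w1)%:R%:E = (\int[P]_w (cst (c w1)%:R%:E) w)%E :> \bar R.
    by rewrite integral_cst //= probability_setT mule1.
  apply: ge0_le_integral => //=.
  - under eq_fun do rewrite -cE.
    apply: emeasurable_sum => i.
    by apply/measurable_EFinP; exact: measurable_indic.
  - by move=> w _; rewrite lee_fin ler_nat.
apply/negP; rewrite -ltNge.
apply: (@lt_le_trans _ _ (\sum_(i : I) a%:E)%E); last exact: lee_sum.
by rewrite sumEFin lte_fin sumr_const -[in ltRHS]mulr_natr.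
Qed.
End Average.

Lemma exists_partial_inverse (T : finType) (n : nat) : (#|T| <= n)%N ->
  exists (enc : T -> 'I_n) (dec : 'I_n -> option T),
    pcancel enc dec /\ ocancel dec enc.
Proof.
move=> le_n; pose enc (x : T) := widen_ord le_n (enum_rank x).
have inj_enc : injective enc.
  by move=> x y /(congr1 val)/= /val_inj/enum_rank_inj.
exists enc, (fun i => [pick x | enc x == i]); split.
- move=> x; case: pickP => [y /eqP/inj_enc->//|/(_ x)].
  by rewrite eqxx.
- by move=> i; case: pickP => //= x /eqP.
Qed.

(** * Resampling one coordinate *)

Section Update.
Context {I V : finType}.

Definition upd (s : {ffun I -> V}) (j : I) (v : V) : {ffun I -> V} :=
  [ffun i => if i == j then v else s i].

Lemma upd_same s j v : upd s j v j = v.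
Proof. by rewrite ffunE eqxx. Qed.

Lemma upd_upd s j v w : upd (upd s j v) j w = upd s j w.
Proof. by apply/ffunP => i; rewrite !ffunE; case: eqP. Qed.

Lemma upd_id s j : upd s j (s j) = s.
Proof. by apply/ffunP => i; rewrite ffunE; case: eqP => // ->. Qed.

(** Resampling coordinate [j] of a uniform [s] leaves it uniform: exchanging [v] with [s j] is an
    involution of the pairs [(s, v)]. *)
Lemma sum_upd (j : I) (F : {ffun I -> V} -> nat) :
  (\sum_s \sum_v F (upd s j v) = #|V| * \sum_s F s)%N.
Proof.
rewrite pair_bigA /=.
pose h (q : {ffun I -> V} * V) := (upd q.1 j q.2, q.1 j).
have hK : involutive h by case=> s v; rewrite /h /= upd_upd upd_id upd_same.
rewrite (reindex_inj (inv_inj hK)) /=.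
rewrite -(pair_bigA _ (fun s v => F (upd (upd s j v) j (s j)))) /=.
under eq_bigr => s _ do under eq_bigr => v _ do rewrite upd_upd upd_id.
by under eq_bigr => s _ do rewrite sum_nat_const; rewrite big_distrr.
Qed.
End Update.

(** * Hard instances and the number of needles a run finds *)

Section HardInstances.
Context {R : realType} {n d h : nat}.
Variables (dec : 'I_n -> option ('I_d * ('I_h * bool))) (delta : R).
Implicit Types (s : {ffun 'I_d -> 'I_h * bool}) (j : 'I_d).

(* [dec] labels a row by its block and its position in the block; rows with no
   label are padding. *)
Definition needles (o : 'I_d -> option ('I_h * bool)) : 'cV[R]_n :=
  \col_i (if dec i is Some x then if o x.1 == Some x.2 then 1 else delta else 0).

Definition hard s := needles (fun j => Some (s j)).
(** Reference instance: independent of [s j], since block [j] is constantly [delta]. *)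
Definition hard_without s j :=
  needles (fun i => if i == j then None else Some (s i)).

(** The sign of a row is dropped on purpose: querying either row of a pair counts as reaching it, so
    an unreached needle stays unreached when its sign is flipped. *)
Definition block_pairs j (tr : seq 'I_n) : seq 'I_h :=
  pmap (fun i => if dec i is Some x then
                   if x.1 == j then Some x.2.1 else None else None) tr.

Lemma sum_size_block_pairs tr : (\sum_j size (block_pairs j tr) <= size tr)%N.
Proof.
elim: tr => [|i tr IH] /=; first by rewrite big1.
case e : (dec i) => [[j0 v]|] /=; last first.
  by apply: leq_trans (leqnSn _); apply: leq_trans IH; apply: leq_sum.
rewrite -addn1 addnC.
apply: (@leq_trans (\sum_j ((j == j0) + size (block_pairs j tr)))).
  by apply: leq_sum => j _; rewrite eq_sym; case: eqP.
rewrite big_split /= leq_add //.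
by rewrite (bigD1 j0) //= eqxx big1 ?addn0 // => j /negPf->.
Qed.

Lemma prefix_block_pairs j t1 t2 :
  prefix t1 t2 -> prefix (block_pairs j t1) (block_pairs j t2).
Proof. by move=> /prefixP[t ->]; rewrite /block_pairs pmap_cat prefix_prefix. Qed.

Lemma mem_block_pairs j k sg tr i :
  i \in tr -> dec i = Some (j, (k, sg)) -> k \in block_pairs j tr.
Proof.
by move=> itr e; rewrite mem_pmap; apply/mapP; exists i; rewrite // e /= eqxx.
Qed.

Lemma hard_agree s s' j (tr : seq 'I_n) :
  (forall i, i != j -> s i = s' i) ->
  (s j).1 \notin block_pairs j tr -> (s' j).1 \notin block_pairs j tr ->
  {in tr, forall i, hard s i 0 = hard s' i 0}.
Proof.
move=> ss' sj s'j i itr; rewrite !mxE.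
case e : (dec i) => [[j' [k sg]]|] //=.
have [ej|/ss'->//] := eqVneq j' j; rewrite ej in e *.
have kj := mem_block_pairs _ _ _ _ _ itr e.
have -> : (Some (s j) == Some (k, sg)) = false.
  by apply/negP => /eqP[es]; move: sj; rewrite es /= kj.
have -> // : (Some (s' j) == Some (k, sg)) = false.
by apply/negP => /eqP[es]; move: s'j; rewrite es /= kj.
Qed.

Lemma hard_without_agree s j (tr : seq 'I_n) :
  (s j).1 \notin block_pairs j tr ->
  {in tr, forall i, hard s i 0 = hard_without s j i 0}.
Proof.
move=> sj i itr; rewrite !mxE.
case e : (dec i) => [[j' [k sg]]|] //=.
have [ej|//] := eqVneq j' j; rewrite ej in e *.
have -> // : (Some (s j) == Some (k, sg)) = false.
apply/negP => /eqP[es]; move: sj.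
by rewrite es /= (mem_block_pairs _ _ _ _ _ itr e).
Qed.

Lemma hard_without_upd s j v : hard_without (upd s j v) j = hard_without s j.
Proof.
apply/colP => i; rewrite !mxE; case: (dec i) => [[j' v']|] //=.
by have [//|j'j] := eqVneq j' j; rewrite ffunE (negPf j'j).
Qed.

Section Run.
Variables (D : query_alg R n d) (T M : nat).

Definition found s j := (s j).1 \in block_pairs j (trace D (hard s) T).
Definition heavy s j := (M < size (block_pairs j (trace D (hard s) T)))%N.

(* Up to the query that reaches the needle of block [j], the run coincides with
   the run on the instance without that needle, whose first [M] queries to the
   block do not depend on the position of the needle. *)
Lemma light_found s j : found s j -> ~~ heavy s j ->
  (s j).1 \in take M (block_pairs j (trace D (hard_without s j) T)).
Proof.
move=> fd; rewrite /heavy -leqNgt => light; apply: contraLR fd => nin.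
(* Induction on time: while the needle pair is unqueried both runs make the same next query, and
   lightness puts it among the first [M] block queries of the reference run, which avoid that
   pair. *)
rewrite /found; suff : forall t, (t <= T)%N ->
    (s j).1 \notin block_pairs j (trace D (hard s) t) by exact.
elim=> [//|t IH] tT.
have e : trace D (hard_without s j) t.+1 = trace D (hard s) t.+1.
  have ag := hard_without_agree _ _ _ (IH (ltnW tT)).
  by rewrite /= (history_agree _ _ _ _ ag) (trace_agree _ _ _ _ ag).
have /prefix_block_pairs-/(_ j)/size_prefix := prefix_trace D (hard s) _ _ tT.
move=> /leq_trans/(_ light) szM.
have /prefix_block_pairs-/(_ j) := prefix_trace D (hard_without s j) _ _ tT.
rewrite e => pre; apply: contra nin => kin.
move: pre szM => /prefixP[u ->] szM.
by rewrite take_cat ltnNge szM /= mem_cat kin.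
Qed.

(** Resample [s j]: the list [L] of at most [M] pairs stays fixed, so at most [2 * M] of the [2 * h]
    needle positions fall into it. *)
Lemma sum_light_found j :
  (h * \sum_s (found s j && ~~ heavy s j) <= M * #|{ffun 'I_d -> 'I_h * bool}|)%N.
Proof.
set X := (\sum_s _)%N.
suff: (2 * h * X <= 2 * M * #|{ffun 'I_d -> 'I_h * bool}|)%N by lia.
have -> : (2 * h = #|{: 'I_h * bool}|)%N.
  by rewrite card_prod card_ord card_bool mulnC.
rewrite -(sum_upd j) [leqRHS]mulnC -sum_nat_const; apply: leq_sum => s _.
pose L := take M (block_pairs j (trace D (hard_without s j) T)).
apply: (@leq_trans (\sum_(v : 'I_h * bool) (v.1 \in L))).
  apply: leq_sum => v _; case fd: (found _ _) => //=; case hv: (heavy _ _) => //=.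
  have := light_found (upd s j v) j fd (negbT hv).
  by rewrite hard_without_upd upd_same => ->.
rewrite -(pair_bigA _ (fun k (_ : bool) => nat_of_bool (k \in L))) /=.
under eq_bigr do rewrite sum_nat_const card_bool.
rewrite -big_distrr /= leq_mul2l /=.
rewrite -big_mkcond sum1_card.
by apply: leq_trans (card_size _) _; rewrite size_take_min geq_minl.
Qed.

Lemma sum_heavy s : (size (trace D (hard s) T) <= T)%N ->
  (M * \sum_j heavy s j <= T)%N.
Proof.
move=> sz; apply: leq_trans sz; apply: leq_trans (sum_size_block_pairs _).
rewrite big_distrr /=; apply: leq_sum => j _.
by rewrite /heavy; case: ltnP => [/ltnW|]; rewrite ?muln1 ?muln0.
Qed.

Hypotheses (hM : h = (8 * M)%N) (TM : (8 * T <= M * d)%N) (M_gt0 : (0 < M)%N).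

(** A found needle is light, which has frequency at most [M / h = 1/8], or lies in a heavy block; by
    Markov's inequality at most [T / M <= d / 8] blocks are heavy. *)
Lemma sum_found :
  (4 * \sum_s \sum_j found s j <= d * #|{ffun 'I_d -> 'I_h * bool}|)%N.
Proof.
set N := #|_|.
have aux X Y : (h * X <= M * Y -> 8 * X <= Y)%N.
  by rewrite hM mulnAC mulnC leq_pmul2l.
have h1 : (8 * \sum_s \sum_j (found s j && ~~ heavy s j) <= d * N)%N.
  rewrite exchange_big /= big_distrr /=.
  rewrite -[d in (d * N)%N]card_ord -sum_nat_const; apply: leq_sum => j _.
  exact: aux (sum_light_found j).
have h2 : (8 * \sum_s \sum_j heavy s j <= d * N)%N.
  rewrite big_distrr /= [leqRHS]mulnC -sum_nat_const; apply: leq_sum => s _.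
  rewrite -(leq_pmul2l M_gt0) mulnCA; apply: leq_trans TM.
  by rewrite leq_pmul2l //; exact: sum_heavy (size_trace _ _ _).
have h3 : (\sum_s \sum_j found s j <=
    \sum_s \sum_j (found s j && ~~ heavy s j) + \sum_s \sum_j heavy s j)%N.
  rewrite -big_split /=; apply: leq_sum => s _; rewrite -big_split /=.
  by apply: leq_sum => j _; case: (found s j); case: (heavy s j).
lia.
Qed.

Definition run_output s := q_out D (history D (hard s) T).

Definition flip s j := upd s j ((s j).1, ~~ (s j).2).

Lemma flipK j : involutive (flip^~ j).
Proof.
move=> s; rewrite /flip upd_upd upd_same /= negbK -[in RHS](upd_id s j).
by case: (s j).
Qed.

Lemma flip_unfound s j : ~~ found s j -> run_output (flip s j) = run_output s.
Proof.
move=> nf.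
have ag : {in trace D (hard s) T, forall i, hard s i 0 = hard (flip s j) i 0}.
  apply: (hard_agree _ _ j) => //.
  - by move=> i ij; rewrite ffunE (negPf ij).
  - by rewrite upd_same.
by rewrite /run_output (history_agree _ _ _ _ ag).
Qed.

(** Pair [s] with [flip s j]: if the needle is unfound both give the same output, which cannot guess
    both signs. Half of the unfound fraction [3/4] gives [3/8]. *)
Lemma sum_wrong (guess : 'cV[R]_d -> 'I_d -> bool -> bool) :
  (forall x j b, guess x j b -> ~~ guess x j (~~ b)) ->
  (3 * (d * #|{ffun 'I_d -> 'I_h * bool}|) <=
   8 * \sum_s \sum_j ~~ guess (run_output s) j (s j).2)%N.
Proof.
move=> gP; set N := #|_|.
pose wr s j := ~~ guess (run_output s) j (s j).2.
have key j : (\sum_s ~~ found s j <= 2 * \sum_s wr s j)%N.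
  rewrite mul2n -addnn [X in (_ <= _ + X)%N](reindex_inj (inv_inj (flipK j))) -big_split /=.
  apply: leq_sum => s _; case nf: (found s j) => //=.
  have e := flip_unfound s j (negbT nf).
  rewrite /wr e upd_same /=.
  by case g : (guess _ _ _) => //=; rewrite (gP _ _ _ g).
have tot : (\sum_s \sum_j ~~ found s j + \sum_s \sum_j found s j = d * N)%N.
  rewrite -big_split /= mulnC -sum_nat_const; apply: eq_bigr => s _.
  rewrite -big_split /= -[d in RHS]card_ord -sum1_card; apply: eq_bigr => j _.
  by case: found.
have := sum_found; rewrite -/N.
have : (\sum_s \sum_j ~~ found s j <= 2 * \sum_s \sum_j wr s j)%N.
  rewrite exchange_big /= [X in (_ <= 2 * X)%N]exchange_big /= big_distrr /=.
  by apply: leq_sum => j _; exact: key.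
move=> le1 le2; change (3 * (d * N) <= 8 * \sum_s \sum_j wr s j)%N; lia.
Qed.

End Run.
End HardInstances.

(** * Cost of the hard instances *)

Section Clamp.
Context {R : realType}.
Implicit Types (b : bool) (delta x y : R).

Definition clamp delta x : R := Num.min delta (Num.max 0 x).

Definition sgnb b : R := if b then 1 else -1.

Lemma sgnb_mulK b x : sgnb b * (sgnb b * x) = x.
Proof. by case: b; rewrite /sgnb ?mul1r // !mulN1r opprK. Qed.

Lemma sgnb_mulN b x : sgnb (~~ b) * x = - (sgnb b * x).
Proof. by case: b; rewrite /sgnb /= ?mul1r ?mulN1r ?opprK. Qed.

Lemma norm_sgnb_mul b x : `|sgnb b * x| = `|x|.
Proof. by case: b; rewrite /sgnb ?mul1r // mulN1r normrN. Qed.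

Lemma clamp_Lip1 delta : 0 <= delta -> Lip1 (clamp delta).
Proof.
move=> d0; rewrite /clamp; split; first by rewrite maxxx; apply/min_idPr.
move=> x y; have := ler_norm (x - y); have := ler_norm (y - x); rewrite (distrC y).
case: (lerP 0 x) => hx; case: (lerP 0 y) => hy;
  
  case: (lerP delta x) => ?; case: (lerP delta y) => ?;
  case: (lerP delta 0) => ?; 
  by move=> h1 h2; rewrite ler_norml; apply/andP; split; lra.
Qed.

Lemma clamp_ge0 delta x : 0 <= delta -> 0 <= clamp delta x.
Proof. by move=> d0; rewrite /clamp le_min d0 le_max lexx. Qed.

Lemma clamp_le delta x : clamp delta x <= delta.
Proof. by rewrite /clamp ge_min lexx. Qed.

Lemma clamp_npos delta x : 0 <= delta -> x <= 0 -> clamp delta x = 0.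
Proof. by move=> d0 x0; rewrite /clamp (max_idPl x0); apply/min_idPr. Qed.

Lemma clamp_saturated delta x : 0 < delta -> (delta <= clamp delta x) = (delta <= x).
Proof. by move=> d0; rewrite /clamp le_min lexx le_max /= leNgt d0. Qed.

End Clamp.

(** On [(0, 1]] the power [p] is at most the square, and with squares the left side is
    [1 - delta + 2 * delta ^+ 2]. *)
Lemma powR_gap {R : realType} (p delta : R) : 2 <= p -> 0 < delta <= 2^-1 ->
  (1 - delta) `^ p + delta `^ p + delta <= 1.
Proof.
move=> p2 /andP[d0 d1].
have pow_le (x : R) : 0 < x <= 1 -> x `^ p <= x ^+ 2.
  by move=> x01; rewrite -powR_mulrn ?ger_powR //; lra.
have := pow_le delta; have := pow_le (1 - delta).
have -> : 0 < 1 - delta <= 1 by lra.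
have -> : 0 < delta <= 1 by lra.
by move=> /(_ isT) + /(_ isT); nra.
Qed.

(** * Cost of one block as a function of its coordinate *)

Section BlockCost.
Context {R : realType} {h : nat}.
Variables (p delta : R).
Hypotheses (p2 : 2 <= p) (delta01 : 0 < delta <= 2^-1) (h_gt0 : (0 < h)%N).
Implicit Types (y : R) (v : 'I_h * bool).

Definition block_cost y v : R :=
  \sum_(q : 'I_h * bool)
    `|clamp delta (sgnb q.2 * y) - (if v == q then 1 else delta)| `^ p.

(** At [y = delta] with the needle's sign, the [h] opposite rows cost [delta]^ p[each, the needle](1
    - delta) [^ p], the rest nothing. *)
Definition block_opt : R := h%:R * delta `^ p + (1 - delta) `^ p.

Let delta0 : 0 <= delta. Proof. by case/andP: delta01 => /ltW. Qed.
Let delta_lt1 : delta < 1. Proof. by case/andP: delta01; lra. Qed.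

(** Every row is first charged as if its target were [delta]; the first two terms correct the charge
    of the needle row. *)
Lemma block_costE y v (g := fun b => clamp delta (sgnb b * y)) :
  block_cost y v = (1 - g v.2) `^ p - (delta - g v.2) `^ p +
    h%:R * ((delta - g v.2) `^ p + (delta - g (~~ v.2)) `^ p).
Proof.
have gP b : 0 <= g b <= delta by rewrite clamp_ge0 ?clamp_le.
have e b : `|g b - delta| = delta - g b.
  by rewrite distrC ger0_norm // subr_ge0; case/andP: (gP b).
have e1 b : `|g b - 1| = 1 - g b.
  by rewrite distrC ger0_norm // subr_ge0; have := delta_lt1; have := gP b; lra.
have tot : \sum_(q : 'I_h * bool) (delta - g q.2) `^ p =
    h%:R * ((delta - g v.2) `^ p + (delta - g (~~ v.2)) `^ p).
  rewrite -(pair_bigA _ (fun _ b => (delta - g b) `^ p)) /=.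
  rewrite sumr_const card_ord big_bool /= mulr_natl.
  by case: v.2 => //=; rewrite addrC.
rewrite -tot /block_cost (bigD1 v) //= eqxx e1 [in RHS](bigD1 v) //= addrA.
rewrite subrK; congr (_ + _); apply: eq_bigr => q qv.
by rewrite eq_sym (negPf qv) e.
Qed.

Lemma block_cost_wrong y v :
  sgnb v.2 * y <= 0 -> block_opt + delta <= block_cost y v.
Proof.
move=> wr; rewrite block_costE (clamp_npos _ _ delta0 wr) !subr0 powR1.
have := powR_gap p delta p2 delta01.
have := powR_ge0 (delta - clamp delta (sgnb (~~ v.2) * y)) p.
move=> /(mulr_ge0 (ler0n R h)); rewrite /block_opt mulrDr; lra.
Qed.

(** The opposite rows vanish under [clamp], and what remains decreases in the clamped value
    [g <= delta], strictly in the needle term; so the optimum forces saturation. *)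
Lemma block_cost_right y v : 0 < sgnb v.2 * y ->
  block_opt <= block_cost y v /\
  (block_cost y v <= block_opt -> delta <= sgnb v.2 * y).
Proof.
move=> ri; rewrite block_costE sgnb_mulN.
rewrite (@clamp_npos _ _ (- _) delta0) ?subr0; last by rewrite oppr_le0 ltW.
set g := clamp _ _.
have gP : 0 <= g <= delta by rewrite clamp_ge0 ?clamp_le.
have : 0 <= (h%:R - 1) * (delta - g) `^ p.
  by rewrite mulr_ge0 ?powR_ge0 // subr_ge0 ler1n.
rewrite mulrBl mulrDr mul1r /block_opt => ge0.
have p0 : 0 < p by apply: lt_le_trans p2.
have mono : (1 - delta) `^ p <= (1 - g) `^ p.
  by apply: ge0_ler_powR; rewrite ?nnegrE; have := delta_lt1; lra.
split; first by move: mono ge0; lra.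
move=> le; rewrite -(clamp_saturated _ _) -/g; last by case/andP: delta01.
rewrite leNgt; apply/negP => lt_g.
have : (1 - delta) `^ p < (1 - g) `^ p.
  by apply: gt0_ltr_powR; rewrite ?nnegrE; have := delta_lt1; lra.
lra.
Qed.

Lemma block_cost_ge y v :
  block_opt + (sgnb v.2 * y <= 0)%R%:R * delta <= block_cost y v.
Proof.
case: (lerP (sgnb v.2 * y) 0) => [/block_cost_wrong|/block_cost_right[+ _]].
  by rewrite mul1r.
by rewrite mul0r addr0.
Qed.

Lemma block_cost_opt v : block_cost (sgnb v.2 * delta) v = block_opt.
Proof.
have d0 : 0 < delta by case/andP: delta01.
rewrite block_costE sgnb_mulN sgnb_mulK (@clamp_npos _ _ (- _) delta0) ?oppr_le0 ?delta0 //.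
have -> : clamp delta delta = delta.
  by apply/eqP; rewrite eq_le clamp_le clamp_saturated /=.
have p0 : p != 0 by rewrite gt_eqF // (lt_le_trans _ p2).
by rewrite subrr subr0 (powR0 p0) subr0 add0r addrC.
Qed.

End BlockCost.

(** * The design matrix and its minimizers *)

Section Design.
Context {R : realType} {n d h : nat}.
Variables (enc : 'I_d * ('I_h * bool) -> 'I_n)
          (dec : 'I_n -> option ('I_d * ('I_h * bool))) (p delta : R).
Hypotheses (encK : pcancel enc dec) (decK : ocancel dec enc).
Hypotheses (p2 : 2 <= p) (delta01 : 0 < delta <= 2^-1) (h_gt0 : (0 < h)%N).
Implicit Types (s : {ffun 'I_d -> 'I_h * bool}) (j : 'I_d) (x : 'cV[R]_d).

Definition design : 'M[R]_(n, d) :=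
  \matrix_(i, j) (if dec i is Some q then
                    if q.1 == j then sgnb q.2.2 else 0 else 0).

Lemma mul_design x i :
  (design *m x) i 0 = if dec i is Some q then sgnb q.2.2 * x q.1 0 else 0.
Proof.
rewrite mxE; under eq_bigr => j _ do rewrite mxE.
case: (dec i) => [q|]; last by rewrite big1 // => j _; rewrite mul0r.
rewrite (bigD1 q.1) //= eqxx big1 ?addr0 // => j /negPf.
by rewrite eq_sym => ->; rewrite mul0r.
Qed.

Lemma sum_dec (F : 'I_d * ('I_h * bool) -> R) :
  \sum_i (if dec i is Some q then F q else 0) = \sum_j \sum_v F (j, v).
Proof.
rewrite (bigID (fun i => dec i : bool)) /= [X in _ + X]big1 ?addr0; last first.
  by move=> i; case: (dec i).
rewrite (reindex_omap enc dec) => [|i]; last first.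
  by move: (decK i); case: (dec i) => //= q ->.
rewrite pair_bigA /= [RHS](eq_bigr F) => [|[] //].
by apply: eq_big => [q|q _]; rewrite encK ?eqxx.
Qed.

Let p0 : p != 0. Proof. by rewrite gt_eqF // (lt_le_trans _ p2). Qed.
Let delta0 : 0 < delta. Proof. by case/andP: delta01. Qed.

Lemma lpp_design x :
  lpp p (design *m x) = \sum_j (h * 2)%:R * `|x j 0| `^ p.
Proof.
transitivity (\sum_j \sum_(v : 'I_h * bool) `|sgnb v.2 * x j 0| `^ p).
  rewrite -(sum_dec (fun q => `|sgnb q.2.2 * x q.1 0| `^ p)).
  apply: eq_bigr => i _; rewrite mul_design.
  by case: (dec i) => //; rewrite normr0 powR0.
apply: eq_bigr => j _; under eq_bigr => v _ do rewrite norm_sgnb_mul.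
by rewrite sumr_const card_prod card_ord card_bool mulr_natl.
Qed.

Lemma cost_hard s x :
  cost p design (clamp delta) (hard dec delta s) x =
  \sum_j block_cost p delta (x j 0) (s j).
Proof.
rewrite /cost /lpp /block_cost -(sum_dec (fun q =>
  `|clamp delta (sgnb q.2.2 * x q.1 0) - (if s q.1 == q.2 then 1 else delta)|
     `^ p)).
apply: eq_bigr => i _; rewrite mxE [map_mx _ _ _ _]mxE mul_design !mxE.
case: (dec i) => [q|]; first by rewrite (inj_eq Some_inj).
by rewrite (clamp_npos _ _ (ltW delta0)) // subrr normr0 powR0.
Qed.

Definition hard_min s : 'cV[R]_d := \col_j (sgnb (s j).2 * delta).

Lemma cost_hard_min s :
  cost p design (clamp delta) (hard dec delta s) (hard_min s) =
  d%:R * block_opt (h := h) p delta.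
Proof.
rewrite cost_hard; under eq_bigr => j _ do rewrite mxE block_cost_opt //.
by rewrite sumr_const card_ord mulr_natl.
Qed.

(** An optimal [y] must be optimal in every block, hence saturated, so [delta] is the least possible
    absolute value of each coordinate. *)
Lemma hard_min_xstar s :
  is_xstar p design (clamp delta) (hard dec delta s) (hard_min s).
Proof.
have ge j y : block_opt (h := h) p delta <= block_cost p delta y (s j).
  apply: le_trans (block_cost_ge _ _ _ _ _ _ _) => //.
  by rewrite lerDl mulr_ge0 // ltW.
split => [y|y y_opt].
  rewrite cost_hard_min cost_hard mulr_natl -[d in _ *+ d]card_ord -sumr_const.
  by apply: ler_sum.
rewrite !lpp_design; apply: ler_sum => j _; rewrite ler_wpM2l //.
have := y_opt (hard_min s); rewrite cost_hard_min cost_hard.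
rewrite mulr_natl -[d in _ *+ d]card_ord -sumr_const => le_sum.
have le_j : block_cost p delta (y j 0) (s j) <= block_opt (h := h) p delta.
  move: le_sum; rewrite (bigD1 j) //= [leRHS](bigD1 j) //= => le_sum.
  have : \sum_(i < d | i != j) block_opt (h := h) p delta <=
         \sum_(i < d | i != j) block_cost p delta (y i 0) (s i).
    by apply: ler_sum.
  by move: le_sum; lra.
have le_delta : delta <= `|y j 0|.
  rewrite -(norm_sgnb_mul (s j).2); apply: le_trans (ler_norm _).
  case: (lerP (sgnb (s j).2 * y j 0) 0) => [|/block_cost_right].
    move/(block_cost_wrong p delta p2 delta01); move: le_j delta0; lra.
  by move=> /(_ p delta p2 delta01 h_gt0)[_]; exact.
rewrite mxE norm_sgnb_mul (gtr0_norm delta0).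
by apply: ge0_ler_powR; rewrite ?nnegrE ?(ltW delta0) // (le_trans _ p2).
Qed.

Lemma good_output_wrong s (eps : R) xh :
  good_output p eps design (clamp delta) (hard dec delta s) xh ->
  (\sum_j ((sgnb (s j).2 * xh j 0 <= 0)%R : nat))%:R * delta <=
  eps * (d%:R * (3 * (h%:R * delta `^ p) + (1 - delta) `^ p)).
Proof.
move=> /(_ _ (hard_min_xstar s)); rewrite cost_hard_min lpp_design.
under [X in _ + _ * (_ + X)]eq_bigr => j _ do
  rewrite mxE norm_sgnb_mul (gtr0_norm delta0).
rewrite sumr_const card_ord cost_hard => le_cost.
have ge_cost : d%:R * block_opt (h := h) p delta +
    (\sum_j ((sgnb (s j).2 * xh j 0 <= 0)%R : nat))%:R * delta <=
    \sum_j block_cost p delta (xh j 0) (s j).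
  rewrite mulr_natl -[d in _ *+ d]card_ord -sumr_const natr_sum mulr_suml.
  by rewrite -big_split /=; apply: ler_sum => j _; apply: block_cost_ge.
move: le_cost ge_cost; rewrite /block_opt -mulr_natl natrM; nra.
Qed.

End Design.

(** * The lower bound *)

Lemma no_fast_algorithm {R : realType} {n d M T : nat} (p eps : R)
    (delta := 40 * eps) {dsp : measure_display} {Om : measurableType dsp}
    (P : probability Om R) (alg : rand_alg R n d Om) :
  2 <= p -> 0 < eps -> delta <= 2^-1 ->
  (0 < d)%N -> (0 < M)%N -> (8 * T <= M * d)%N -> (16 * M * d <= n)%N ->
  (8 * M)%:R * delta `^ p <= 1 ->
  succeeds p eps P alg ->
  ~ (forall A b f w, Lip1 f ->
       q_next (alg A f w) (history (alg A f w) b T) = None).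
Proof.
move=> p2 eps0 delta1 d0 M0 TM Mn Mdelta succ halt.
set h := (8 * M)%N in Mdelta.
have delta0 : 0 < delta by rewrite mulr_gt0.
have delta01 : 0 < delta <= 2^-1 by rewrite delta0.
have h0 : (0 < h)%N by rewrite muln_gt0.
have [|enc [dec [encK decK]]] :=
    exists_partial_inverse ('I_d * ('I_h * bool))%type n.
  by rewrite !card_prod !card_ord card_bool /h; lia.
pose A := design dec : 'M[R]_(n, d).
have fL : Lip1 (clamp delta) by apply/clamp_Lip1/ltW.
have /boolp.choice[S SP] s := succ A (hard dec delta s) (clamp delta) fL.
have [w popular] := exists_popular P _ S (4 / 5)
  (fun s => (SP s).1) (fun s => (SP s).2.1).
set D := alg A (clamp delta) w.
set G := [set s | w \in S s] in popular.
pose N := #|{ffun 'I_d -> 'I_h * bool}|.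
have N0 : (0 < N)%N.
  by apply/card_gt0P; exists (finfun (fun _ : 'I_d => (Ordinal h0, true))).
have GN : (4 * N <= 5 * #|G|)%N.
  by rewrite -(ler_nat R) !natrM; move: popular; rewrite -/N; lra.
pose out := run_output dec delta D T.
pose wrong (s : {ffun 'I_d -> 'I_h * bool}) := (\sum_j ((sgnb (s j).2 * out s j 0 <= 0)%R : nat))%N.
(* At most [d / 10] wrong signs on good instances, trivially at most [d] on the others. *)
have wrong_le s : (10 * wrong s + 9 * d * (s \in G) <= 10 * d)%N.
  case: (boolP (s \in G)) => [|_]; last first.
    rewrite muln0 addn0 leq_mul2l /= -[leqRHS]card_ord -sum1_card.
    by apply: leq_sum => j _; case: (_ <= _)%R.
  rewrite inE => /set_mem Sw; have [xh [hxh good]] := (SP s).2.2 w Sw.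
  have xhE : xh = out s by apply: halts_with_history hxh; apply: halt.
  rewrite {}xhE {hxh} in good.
  have := good_output_wrong _ _ _ _ encK decK p2 delta01 h0 _ _ _ good.
  rewrite -[\sum_j _]/(wrong s) => le_wrong.
  suff: (10 * wrong s <= d)%N by lia.
  have le1 : (1 - delta) `^ p <= 1.
    by have := powR_gap p delta p2 delta01; have := powR_ge0 delta p; lra.
  have le4 : d%:R * (3 * (h%:R * delta `^ p) + (1 - delta) `^ p) <= d%:R * 4 :> R.
    by rewrite ler_wpM2l //; lra.
  have := le_trans le_wrong (ler_wpM2l (ltW eps0) le4).
  rewrite /delta mulrA [_ * eps]mulrC ler_pM2l // => le_d.
  by rewrite -(ler_nat R) natrM; lra.
(* The strict inequality makes a zero coordinate a wrong guess for both signs. *)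
have := @sum_wrong R n d h dec delta D T M erefl TM M0
  (fun x j b => 0 < sgnb b * x j 0) _.
rewrite -/N => lower.
have {lower} : (3 * (d * N) <= 8 * \sum_s wrong s)%N.
  have e : (\sum_s wrong s =
      \sum_(s : {ffun 'I_d -> 'I_h * bool}) \sum_j ~~ (0 < sgnb (s j).2 * out s j 0)%R)%N.
    by apply: eq_bigr => s _; apply: eq_bigr => j _; rewrite leNgt.
  rewrite e; apply: lower => x j b.
  by rewrite sgnb_mulN oppr_gt0 -leNgt => /ltW.
have : (10 * \sum_s wrong s + 9 * d * #|G| <= 10 * d * N)%N.
  rewrite -sum1_card [X in (_ + 9 * d * X)%N]big_mkcond /= !big_distrr /=.
  rewrite -big_split /= [leqRHS]mulnC -sum_nat_const.
  by apply: leq_sum => s _; apply: leq_trans (wrong_le s); case: (_ \in _).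
have dN : (0 < d * N)%N by rewrite muln_gt0 d0.
have : (4 * (d * N) <= 5 * (d * #|G|))%N by rewrite !(mulnCA _ d) leq_mul2l GN orbT.
(* The bounds collide: [W] is at least [3/8] but at most [7/25] of [d * N]. *)
move: (\sum_s _)%N => W; lia.
Qed.

Theorem theorem3 (R : realType) (p : R) (hp : 2 < p) :
  exists c C : R, 0 < c /\ 0 < C /\
  exists eps0 : R, 0 < eps0 /\
  forall eps : R, 0 < eps -> eps < eps0 ->
  forall d n : nat, C * d%:R / eps `^ p <= n%:R ->
  forall (dsp : measure_display) (Om : measurableType dsp) (P : probability Om R)
         (alg : rand_alg R n d Om),
    succeeds p eps P alg ->
    exists (A : 'M[R]_(n, d)) (b : 'cV[R]_n) (f : R -> R) (w : Om),
      Lip1 f /\ makes_at_least (alg A f w) b (c * d%:R / eps `^ p).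
Proof.
pose K : R := 40 `^ p.
have K0 : 0 < K by rewrite powR_gt0.
exists (128 * K)^-1, (2 / K).
rewrite invr_gt0 mulr_gt0 // divr_gt0 //; do 2!split=> //.
exists 160^-1; rewrite invr_gt0 ltr0n; split=> // eps eps0 eps1 d n dn dsp Om P alg succ.
set t : R := _ / eps `^ p.
apply: contrapT => none.
have halts A b f w : Lip1 f ->
    exists2 j, j%:R < t & q_next (alg A f w) (history (alg A f w) b j) = None.
  move=> fL; apply: contrapT => nj; apply: none.
  exists A, b, f, w; split=> // j jt qj; apply: nj; by exists j.
pose delta := 40 * eps.
have e0 : 0 < eps `^ p by rewrite powR_gt0.
have deltaE : delta `^ p = K * eps `^ p by rewrite powRM // ltW.
have delta_p0 : 0 < delta `^ p by rewrite deltaE mulr_gt0.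
have delta2 : 8 * delta `^ p <= 1.
  have d01 : 0 < delta <= 1 by rewrite /delta; lra.
  have := ger_powR d01 (ltW hp); rewrite powR_mulrn; last by rewrite /delta; lra.
  by rewrite /delta expr2; nra.
pose M := Num.truncn (8 * delta `^ p)^-1.
have [lM uM] : M%:R <= (8 * delta `^ p)^-1 /\ (8 * delta `^ p)^-1 < M.+1%:R.
  have /truncn_itv/andP[] // : 0 <= (8 * delta `^ p)^-1.
  by rewrite invr_ge0 mulr_ge0 // ltW.
have M0 : (0 < M)%N.
  rewrite -ltnS -(ltr_nat R); apply: le_lt_trans uM.
  by rewrite invf_ge1 ?mulr_gt0.
have hM : (8 * M)%:R * delta `^ p <= 1.
  rewrite natrM mulrAC mulrC -ler_pdivlMr ?mulr_gt0 //.
  by rewrite div1r.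
(* For [d = 0] the bound [t] is 0, and no run can halt in fewer than 0 steps. *)
have [d0|d0] := posnP d.
  have t0 : t = 0 by rewrite /t d0 mulr0 mul0r.
  have [w _] := probability_inhabited P.
  have [j] := halts 0 0 (clamp 0) w (clamp_Lip1 _ (lexx 0)).
  by rewrite t0 ltNge ler0n.
have tE : t = d%:R / 16 * (8 * delta `^ p)^-1.
  by rewrite /t deltaE; field; rewrite !gt_eqF.
(* Rounding down loses at most a factor 2, so that [t <= M * d / 8]. *)
have M2 : (8 * delta `^ p)^-1 <= 2 * M%:R.
  apply: le_trans (ltW uM) _; rewrite -natrM ler_nat; lia.
have t0 : 0 <= t by rewrite tE mulr_ge0 ?divr_ge0 // invr_ge0 mulr_ge0 // ltW.
pose T := Num.truncn t.
have lT : T%:R <= t by have /andP[] := truncn_itv t0.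
have d0R : 0 < d%:R :> R by rewrite ltr0n.
have TM : (8 * T <= M * d)%N.
  rewrite -(ler_nat R) !natrM.
  have := ler_wpM2l (ltW d0R) M2; move: lT; rewrite tE; lra.
have Mn : (16 * M * d <= n)%N.
  rewrite -(ler_nat R); apply: le_trans dn; rewrite !natrM.
  have -> : 2 / K * d%:R / eps `^ p = 16 * d%:R * (8 * delta `^ p)^-1.
    by rewrite deltaE; field; rewrite !gt_eqF.
  by have := ler_wpM2l (ltW d0R) lM; lra.
apply: (no_fast_algorithm p eps P alg (ltW hp) eps0 _ d0 M0 TM Mn hM succ).
  by lra.
(* A run halting at [j < t] has [j <= T], and its history is frozen from then on. *)
move=> A b f w fL; have [j jt qj] := halts A b f w fL.
rewrite (history_halted _ _ _ _ _ qj) //.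
by rewrite truncn_ge_nat // ltW.
Qed.
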